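(* Let $G$ be a simple graph on $n$ vertices $v_1,\dots,v_n$. Then frames generated by $G$ are unitary equivalent; that is, if $\{f_i\}_{i\in[n]}$ and $\{g_i\}_{i\in[n]}$ are two $G(n,k)$-frames for $\mathbb{C}^k$, then there is a unitary operator $U:\mathbb{C}^k\to\mathbb{C}^k$ with $U(g_i)=f_i$ for all $i\in[n]$.
   Context: $[n]=\{1,\dots,n\}$. A sequence $\{f_i\}_{i\in[n]}$ in $\mathbb{C}^k$ is a frame for $\mathbb{C}^k$ if there are constants $A,B>0$ with $A\|f\|^2\le\sum_{i\in[n]}|\langle f,f_i\rangle|^2\le B\|f\|^2$ for all $f\in\mathbb{C}^k$. Its Gramian matrix $\mathcal{G}$ is the $n\times n$ matrix whose $(i,j)$ entry is $\langle f_j,f_i\rangle$ (inner product linear in the first argument). The Laplacian matrix of a simple graph $G$ with vertices $v_1,\dots,v_n$ is $L(G)=D(G)-A(G)$, where $D(G)$ is the diagonal matrix of vertex degrees and $A(G)$ is the adjacency matrix. A frame $\{f_i\}_{i\in[n]}$ for $\mathbb{C}^k$ is called a frame generated by $G$, or a $G(n,k)$-frame, if its Gramian matrix equals $L(G)$ (necessarily $k=\operatorname{rank} L(G)$). *)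

(* Defs.v *)
From HB Require Import structures.
From mathcomp Require Import all_boot all_order all_algebra.
From mathcomp Require Import spectral complex reals.

Set Implicit Arguments.
Unset Strict Implicit.
Unset Printing Implicit Defensive.

Import Order.TTheory GRing.Theory Num.Theory.

Local Open Scope ring_scope.
Local Open Scope complex_scope.

(* C^k is the space of row vectors 'rV[R[i]]_k with dotmx as inner product,
   which is linear in its first argument: dotmx u v = \sum_j u_j * (v_j)^*. *)

(* dotmx u u is the squared Euclidean norm of u. *)
Definition is_frame (R : realType) (n k : nat) (f : 'I_n -> 'rV[R[i]]_k) : Prop :=
  exists A B : R, [/\ 0 < A, 0 < B &
    forall u : 'rV[R[i]]_k,
      A%:C * dotmx u u <= \sum_(i < n) `|dotmx u (f i)| ^+ 2 <= B%:C * dotmx u u].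

Definition gramian (R : realType) (n k : nat) (f : 'I_n -> 'rV[R[i]]_k) : 'M[R[i]]_n :=
  \matrix_(i, j) dotmx (f j) (f i).

Record simple_graph (n : nat) := SimpleGraph {
  adj :> rel 'I_n;
  adj_sym : symmetric adj;
  adj_irr : irreflexive adj
}.

Definition degree (n : nat) (G : simple_graph n) (i : 'I_n) : nat :=
  #|[set j | adj G i j]|.

Definition degree_mx (C : pzRingType) (n : nat) (G : simple_graph n) : 'M[C]_n :=
  diag_mx (\row_i (degree G i)%:R).

Definition adjacency_mx (C : pzRingType) (n : nat) (G : simple_graph n) : 'M[C]_n :=
  \matrix_(i, j) (adj G i j)%:R.

Definition laplacian (C : pzRingType) (n : nat) (G : simple_graph n) : 'M[C]_n :=
  degree_mx C G - adjacency_mx C G.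

Definition generated_frame (R : realType) (n k : nat) (G : simple_graph n)
    (f : 'I_n -> 'rV[R[i]]_k) : Prop :=
  is_frame f /\ gramian f = laplacian R[i] G.

(* lin1_mx U is the matrix M of U acting on row vectors, U u = u *m M. *)
Definition unitary_operator (R : realType) (k : nat)
    (U : {linear 'rV[R[i]]_k -> 'rV[R[i]]_k}) : Prop :=
  lin1_mx U \is unitarymx.

(* Main.v *)
Require Import Defs.
From mathcomp Require Import all_boot all_order all_algebra.
From mathcomp Require Import complex reals.
From mathcomp Require Import spectral.

(** A frame with vectors in C^k is recorded by the n x k matrix F whose rows are
    its vectors, the analysis operator being u |-> u *m F^t*.  The Gramian of
    the frame is the transpose of F *m F^t*, so two frames with the same Gramian,
    of matrices F and H, satisfy F *m F^t* = H *m H^t*.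

    The lower frame bound makes the analysis operator of H injective
    ([frame_row_free]); since k is finite, H then has a left inverse B, and
    M := B *m F is the only candidate for a matrix with H *m M = F.  It works
    ([unitary_factor]): M *m M^t* = B *m H *m H^t* *m B^t* is the identity, while
    F *m M^t* = F *m F^t* *m B^t* = H *m (B *m H)^t* = H, and multiplying this by
    M on the right gives F = H *m M because the square matrix M is unitary.  Two
    frames generated by one graph have its Laplacian as their common Gramian. *)

Set Implicit Arguments.
Unset Strict Implicit.
Unset Printing Implicit Defensive.

Import Order.TTheory GRing.Theory Num.Theory.

Local Open Scope ring_scope.
Local Open Scope sesquilinear_scope.

Lemma trmxC_mul (C : numClosedFieldType) (m n p : nat)
    (A : 'M[C]_(m, n)) (B : 'M[C]_(n, p)) :
  (A *m B)^t* = B^t* *m A^t*.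
Proof. by rewrite trmx_mul map_mxM. Qed.

(** Unitarity of the quotient comes first, because it yields the factorisation:
    cancelling M against its adjoint avoids any discussion of row spaces. *)
Lemma unitary_factor (C : numClosedFieldType) (n k : nat)
    (F H : 'M[C]_(n, k)) (B : 'M[C]_(k, n)) :
  F *m F^t* = H *m H^t* -> B *m H = 1%:M ->
  B *m F \is unitarymx /\ H *m (B *m F) = F.
Proof.
move=> eqFH BH1.
have adjFM : F *m (B *m F)^t* = H.
  by rewrite trmxC_mul mulmxA eqFH -mulmxA -trmxC_mul BH1 trmx1 map_mx1 mulmx1.
have unitM : B *m F \is unitarymx.
  by apply/unitarymxP; rewrite -mulmxA adjFM.
by split=> //; rewrite -[X in X *m _]adjFM mulmxKtV.
Qed.

Section FrameMatrix.

Variables (R : realType) (n k : nat).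
Implicit Types f : 'I_n -> 'rV[R[i]]_k.

Definition frame_mx f : 'M[R[i]]_(n, k) := \matrix_i f i.

Lemma mul_frame_mxC f (u : 'rV[R[i]]_k) (j : 'I_n) :
  (u *m (frame_mx f)^t*) 0 j = dotmx u (f j).
Proof.
by rewrite dotmxE !mxE; apply: eq_bigr => l _; rewrite !mxE.
Qed.

Lemma gramianE f : (gramian f)^T = frame_mx f *m (frame_mx f)^t*.
Proof.
apply/matrixP => a b; rewrite !mxE dotmxE !mxE.
by apply: eq_bigr => l _; rewrite !mxE.
Qed.

(** A vector killed by the analysis operator is orthogonal to the whole frame, so
    the lower frame bound forces its norm to vanish. *)
Lemma frame_row_free f : is_frame f -> row_free ((frame_mx f)^t*).
Proof.
case=> A [B [A_gt0 _ bounds]]; apply: inj_row_free => u uF0.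
have /andP[lower _] := bounds u.
apply/eqP; apply: contraTT lower => u_neq0.
rewrite big1 => [|j _]; last by rewrite -mul_frame_mxC uF0 mxE normr0 expr0n.
by rewrite lt_geF // mulr_gt0 ?dotmx_is_dotmx // ltcR.
Qed.

End FrameMatrix.

Theorem theorem3p6 (R : realType) (n k : nat) (G : simple_graph n)
    (f g : 'I_n -> 'rV[R[i]]_k) :
  generated_frame G f -> generated_frame G g ->
  exists U : {linear 'rV[R[i]]_k -> 'rV[R[i]]_k},
    unitary_operator U /\ forall i : 'I_n, U (g i) = f i.
Proof.
move=> [_ gramf] [frame_g gramg].
have eqGram : frame_mx f *m (frame_mx f)^t* = frame_mx g *m (frame_mx g)^t*.
  by rewrite -!gramianE gramf gramg.
have /row_freeP[B' gB'1] := frame_row_free frame_g.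
have B'g1 : B'^t* *m frame_mx g = 1%:M.
  by rewrite -[frame_mx g]trmxCK -trmxC_mul gB'1 trmx1 map_mx1.
have [unitM gM] := unitary_factor eqGram B'g1.
exists (mulmxr (B'^t* *m frame_mx f)); split.
  rewrite /unitary_operator; congr (_ \is unitarymx): unitM.
  by apply/row_matrixP => j; rewrite !rowE mul_rV_lin1.
move=> i /=.
by rewrite -[g i](rowK g) -row_mul [X in row i X]gM rowK.
Qed.
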